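(* Fix a positive integer $n$, let $W_n$ be the $n\times n$ companion matrix of $x^n-1$ (the fundamental circulant matrix), and let $A=g(W_n)$ for some $g(x)\in\mathbb{Q}[x]$ with $1\le \deg g\le n-1$. For each divisor $d$ of $n$, let $\zeta_d$ be a primitive $d$-th root of unity, let $\Phi_d(x)$ be the $d$-th cyclotomic polynomial, and let $\chi_{\Phi_d,g}(x)$ be the minimal polynomial of $g(\zeta_d)$ over $\mathbb{Q}$. Then: (1) the minimal polynomial $p_A(x)$ of $A$ is the maximal square-free factor of $\prod_{d\mid n}\chi_{\Phi_d,g}(x)$, and $\deg \chi_{\Phi_d,g}(x)$ divides $\deg \Phi_d(x)$ for each $d\mid n$; (2) the number of irreducible factors of $p_A(x)$ in $\mathbb{Q}[x]$ is at most the number of divisors of $n$; (3) for each $d\mid n$, $\mathbb{Q}(g(\zeta_d))\cong \mathbb{Q}[A]/\langle \chi_{\Phi_d,g}(A)\rangle$. Furthermore, if $n=p$ is prime, then $p_A(x)$ has exactly two irreducible factors in $\mathbb{Q}[x]$, one of degree $1$ and the other of degree dividing $p-1$.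
   Context: $W_n$ is the $n\times n$ $0,1$-matrix with $(i,i+1)$ entries equal to $1$ for $1\le i\le n-1$, $(n,1)$ entry equal to $1$, and all other entries $0$. $\mathbb{Q}[A]$ is the algebra of polynomials in $A$ with rational coefficients and $\langle B\rangle$ denotes the ideal of $\mathbb{Q}[A]$ generated by $B$. The maximal square-free factor of a polynomial is the product of its distinct monic irreducible factors. *)

(* Defs.v *)
From HB Require Import structures.
From mathcomp Require Import all_boot all_order all_algebra all_field.
From mathcomp Require Import boolp.

Set Implicit Arguments.
Unset Strict Implicit.
Unset Printing Implicit Defensive.
Import GRing.Theory.
Local Open Scope ring_scope.
Local Open Scope quotient_scope.

(* Not meaningful at 0, where it returns 0. *)
Definition deg (R : nzSemiRingType) (p : {poly R}) : nat := (size p).-1.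

(* Indices start at 0, so the (n,1) entry is the entry (n.-1, 0). *)
Definition fund_circ (n : nat) : 'M[rat]_n :=
  \matrix_(i < n, j < n)
    ((val j == i.+1) || ((i.+1 == n) && (val j == 0%N)))%:R.

Definition evalC (g : {poly rat}) (z : algC) : algC :=
  (map_poly (ratr : rat -> algC) g).[z].

(* The rational polynomial whose image in algC[X] is minCpoly z. *)
Definition minQpoly (z : algC) : {poly rat} := s2val (minCpolyP z).

Lemma minQpolyE z : map_poly ratr (minQpoly z) = minCpoly z.
Proof. by case: (s2valP (minCpolyP z)). Qed.

Definition monic_irr_factors (F : fieldType) (f : {poly F}) (s : seq {poly F}) :=
  uniq s /\
  forall q, q \in s <-> [/\ q \is monic, irreducible_poly q & q %| f].

Definition max_sqfree_factor (F : fieldType) (f r : {poly F}) :=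
  exists2 s, monic_irr_factors f s & r = \prod_(q <- s) q.

Definition ring_isomorphic (R S : pzRingType) :=
  exists f : {rmorphism R -> S}, bijective f.

Section MatrixAlgebra.
Variables (F : fieldType) (n : nat) (A : 'M[F]_n.+1).

Definition in_mxalg : {pred 'M[F]_n.+1} :=
  [pred X | `[< exists p : {poly F}, X = horner_mx A p >]].

Fact in_mxalgP X : reflect (exists p, X = horner_mx A p) (X \in in_mxalg).
Proof. exact: asboolP. Qed.

Fact in_mxalg_subring : subring_closed in_mxalg.
Proof.
split.
- by apply/in_mxalgP; exists 1; rewrite rmorph1.
- move=> _ _ /in_mxalgP[p ->] /in_mxalgP[q ->]; apply/in_mxalgP.
  by exists (p - q); rewrite rmorphB.
- move=> _ _ /in_mxalgP[p ->] /in_mxalgP[q ->]; apply/in_mxalgP.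
  by exists (p * q); rewrite rmorphM.
Qed.

HB.instance Definition _ :=
  GRing.isSubringClosed.Build 'M[F]_n.+1 in_mxalg in_mxalg_subring.

(* F[A], as a commutative subring of the n.+1 x n.+1 matrices. *)
Record mxalg := MxAlg { mxalg_val :> 'M[F]_n.+1; _ : mxalg_val \in in_mxalg }.

HB.instance Definition _ := [isSub for mxalg_val].
HB.instance Definition _ := [Choice of mxalg by <:].
HB.instance Definition _ := [SubChoice_isSubNzRing of mxalg by <:].

Fact mxalg_mulC (x y : mxalg) : x * y = y * x.
Proof.
apply: val_inj; rewrite !rmorphM /=.
case: x y => _ /= /in_mxalgP[p ->] [_ /= /in_mxalgP[q ->]].
by rewrite -!rmorphM mulrC.
Qed.

HB.instance Definition _ :=
  GRing.PzRing_hasCommutativeMul.Build mxalg mxalg_mulC.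

Fact horner_in_mxalg p : horner_mx A p \in in_mxalg.
Proof. by apply/in_mxalgP; exists p. Qed.

Definition mxalg_horner (p : {poly F}) : mxalg := MxAlg (horner_in_mxalg p).

End MatrixAlgebra.

(* The library's ring structure on {ideal_quot _} requires a proper ideal;   *)
(* here the ideal generated by b may be the whole ring.                      *)
Section PrincipalQuotient.
Variables (R : comNzRingType) (b : R).

Definition gen_ideal : {pred R} := [pred x | `[< exists y, x = y * b >]].

Fact gen_idealP x : reflect (exists y, x = y * b) (x \in gen_ideal).
Proof. exact: asboolP. Qed.

Fact gen_ideal_zmod : zmod_closed gen_ideal.
Proof.
split; first by apply/gen_idealP; exists 0; rewrite mul0r.
move=> _ _ /gen_idealP[x ->] /gen_idealP[y ->]; apply/gen_idealP.
by exists (x - y); rewrite mulrBl.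
Qed.

HB.instance Definition _ := GRing.isZmodClosed.Build R gen_ideal gen_ideal_zmod.

Fact gen_idealMl a x : x \in gen_ideal -> a * x \in gen_ideal.
Proof.
by move=> /gen_idealP[y ->]; apply/gen_idealP; exists (a * y); rewrite mulrA.
Qed.

Definition gen_quot := {ideal_quot gen_ideal}.

HB.instance Definition _ := ZmodQuotient.on gen_quot.

Definition gen_quot_one : gen_quot := lift_cst gen_quot 1.
Definition gen_quot_mul := lift_op2 gen_quot *%R.

Canonical pi_gen_quot_one_morph := PiConst gen_quot_one.

Lemma pi_gen_quot_mul : {morph \pi_gen_quot : x y / x * y >-> gen_quot_mul x y}.
Proof.
move=> x y; unlock gen_quot_mul; apply/eqP; rewrite piE Quotient.equivE.
rewrite -[_ * _](addrNK (x * repr (\pi_gen_quot y))) -mulrBr.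
rewrite -addrA -mulrBl rpredD //.
  by rewrite gen_idealMl // Quotient.idealrDE opprK reprK.
by rewrite mulrC gen_idealMl // Quotient.idealrDE opprK reprK.
Qed.
Canonical pi_gen_quot_mul_morph := PiMorph2 pi_gen_quot_mul.

Fact gen_quot_mulA : associative gen_quot_mul.
Proof. by move=> x y z; rewrite -[x]reprK -[y]reprK -[z]reprK !piE mulrA. Qed.

Fact gen_quot_mulC : commutative gen_quot_mul.
Proof. by move=> x y; rewrite -[x]reprK -[y]reprK !piE mulrC. Qed.

Fact gen_quot_mul1 : left_id gen_quot_one gen_quot_mul.
Proof. by move=> x; rewrite -[x]reprK !piE mul1r. Qed.

Fact gen_quot_mulDl : left_distributive gen_quot_mul +%R.
Proof.
move=> x y z; rewrite -[x]reprK -[y]reprK -[z]reprK.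
by rewrite -!pi_gen_quot_mul -!pi_addr -pi_gen_quot_mul mulrDl.
Qed.

HB.instance Definition _ := GRing.Zmodule_isComPzRing.Build gen_quot
  gen_quot_mulA gen_quot_mulC gen_quot_mul1 gen_quot_mulDl.

End PrincipalQuotient.

Section NumberField.
Variable a : algC.

(* The smallest subfield of algC containing a; it contains the rationals. *)
Definition in_Qadj : {pred algC} :=
  [pred x | `[< forall K : divringClosed algC, a \in K -> x \in K >]].

Fact in_QadjP x :
  reflect (forall K : divringClosed algC, a \in K -> x \in K) (x \in in_Qadj).
Proof. exact: asboolP. Qed.

Fact in_Qadj_divring : divring_closed in_Qadj.
Proof.
split; first by apply/in_QadjP=> K _; apply: rpred1.
- move=> x y /in_QadjP Kx /in_QadjP Ky; apply/in_QadjP=> K Ka.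
  by rewrite rpredB ?Kx ?Ky.
- move=> x y /in_QadjP Kx /in_QadjP Ky; apply/in_QadjP=> K Ka.
  by rewrite rpred_div ?Kx ?Ky.
Qed.

HB.instance Definition _ :=
  GRing.isDivringClosed.Build algC in_Qadj in_Qadj_divring.

Record Qadj := MkQadj { Qadj_val :> algC; _ : Qadj_val \in in_Qadj }.

HB.instance Definition _ := [isSub for Qadj_val].
HB.instance Definition _ := [Choice of Qadj by <:].
HB.instance Definition _ := [SubChoice_isSubIntegralDomain of Qadj by <:].
HB.instance Definition _ := [SubIntegralDomain_isSubField of Qadj by <:].

End NumberField.

(* Main.v *)
Require Import Defs.
From HB Require Import structures.
From mathcomp Require Import all_boot all_order all_algebra all_field.
From mathcomp Require Import boolp.
Import GRing.Theory.
Local Open Scope ring_scope.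

(* The first row of W^k, k < n, is the k-th unit vector and W^n = 1, so W has
   minimal polynomial X^n - 1, which vanishes exactly at the conjugates of the
   zeta_d, d | n.  Hence q(A) = (q o g)(W) = 0 iff q(g(zeta_d)) = 0 for all
   d | n, iff every chi_d divides q, and p_A is the product of the distinct
   chi_d.  The degree claim is the tower law for Q(g(zeta_d)) in Q(zeta_d).
   Both Q(g(zeta_d)) and Q[A]/<chi_d(A)> are quotients of Q[X] with kernel
   (chi_d), because chi_d divides p_A.  If n is prime and chi_1 = chi_n, then
   g - g(1) vanishes at all n-th roots of unity, which is impossible as
   1 <= deg g < n. *)

Set Implicit Arguments.
Unset Strict Implicit.

(** * Products of monic irreducible polynomials *)

Lemma monic_irreducible_dvdp (F : fieldType) (p q : {poly F}) :
    p \is monic -> irreducible_poly p -> q \is monic -> irreducible_poly q ->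
  p %| q -> p = q.
Proof.
move=> mp [p_gt1 _] mq [_ irrq] p_q; apply/eqP; rewrite -eqp_monic //.
by apply: irrq; rewrite // neq_ltn p_gt1 orbT.
Qed.

Lemma irreducible_dvdp_prod (F : fieldType) (q : {poly F}) (r : seq {poly F}) :
  irreducible_poly q -> q %| \prod_(p <- r) p -> exists2 p, p \in r & q %| p.
Proof.
move=> irrq; elim: r => [|p r IHr]; rewrite ?big_nil ?big_cons.
  by rewrite dvdp1; case: irrq => /ltn_eqF; rewrite eq_sym => ->.
have [q_p _|nq_p] := boolP (q %| p); first by exists p; rewrite ?mem_head.
rewrite Gauss_dvdpr ?irreducible_poly_coprime // => /IHr[p' rp' q_p'].
by exists p'; rewrite // inE rp' orbT.
Qed.

(** [r] may contain repetitions: it serves both for the list of all [chi d] and for its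
    duplicate-free version [s]. *)
Lemma monic_irr_factors_prod (F : fieldType) (r s : seq {poly F}) :
    {in r, forall q, q \is monic /\ irreducible_poly q} ->
  uniq s -> s =i r -> monic_irr_factors (\prod_(q <- r) q) s.
Proof.
move=> irr_r uniq_s eq_sr; split=> // q; rewrite eq_sr; split=> [rq | [mq irrq]].
  have [mq irrq] := irr_r _ rq; split=> //.
  by rewrite (big_rem q) //= dvdp_mulr.
case/(irreducible_dvdp_prod irrq) => p rp q_p; have [mp irrp] := irr_r _ rp.
by rewrite (monic_irreducible_dvdp mq irrq mp irrp q_p).
Qed.

(** Distinct monic irreducible polynomials are coprime, so Gauss's lemma splits off one factor at a
    time. *)
Lemma dvdp_prod_irreducible (F : fieldType) (f : {poly F}) (s : seq {poly F}) :
    uniq s -> {in s, forall q, q \is monic /\ irreducible_poly q} ->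
  (\prod_(q <- s) q %| f) = all (fun q => q %| f) s.
Proof.
elim: s => [|q s IHs] /=; first by rewrite big_nil dvd1p.
case/andP=> s'q uniq_s irr_s; have [mq irrq] := irr_s _ (mem_head q s).
have irr_s' : {in s, forall q, q \is monic /\ irreducible_poly q}.
  by move=> p sp; apply: irr_s; rewrite inE sp orbT.
rewrite big_cons Gauss_dvdp ?IHs // irreducible_poly_coprime //.
apply: contra s'q => /(irreducible_dvdp_prod irrq)[p sp q_p].
have [mp irrp] := irr_s' _ sp.
by rewrite (monic_irreducible_dvdp mq irrq mp irrp q_p).
Qed.

(** * Minimal polynomials over the rationals *)

Lemma minQpoly_monic z : minQpoly z \is monic.
Proof. by case: (s2valP (minCpolyP z)). Qed.

Lemma minQpoly_dvd z q : (minQpoly z %| q) = (evalC q z == 0).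
Proof. exact: esym (s2valP' (minCpolyP z) q). Qed.

Lemma minQpoly_irr z : irreducible_poly (minQpoly z).
Proof.
split=> [|q q_neq1 q_z].
  by have := size_minCpoly z; rewrite -minQpolyE size_map_poly.
have mz_neq0 := monic_neq0 (minQpoly_monic z).
have := minQpoly_dvd z (minQpoly z); rewrite dvdpp => /esym/eqP.
have [r Dz] := dvdpP _ _ q_z.
rewrite {1}Dz /evalC rmorphM hornerM => /eqP; rewrite mulf_eq0.
have [r_neq0 q_neq0] : r != 0 /\ q != 0.
  by apply/andP; rewrite -negb_or -mulf_eq0 -Dz.
rewrite -!/(evalC _ _) -!minQpoly_dvd => /orP[z_r|z_q]; last first.
  by apply/andP.
have /eqp_size: r %= minQpoly z by rewrite /eqp z_r Dz dvdp_mulr.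
have q_gt0 : (0 < size q)%N by rewrite size_poly_gt0.
have r_gt0 : (0 < size r)%N by rewrite size_poly_gt0.
rewrite Dz size_mul // -(prednK q_gt0) addnS -{1}[size r]addn0 => /eqP /=.
by rewrite eqn_add2l -eqSS prednK // eq_sym (negPf q_neq1).
Qed.

Lemma evalC_comp q g z : evalC (q \Po g) z = evalC q (evalC g z).
Proof. by rewrite /evalC map_comp_poly horner_comp. Qed.

Lemma evalC_ratr g a : evalC g (ratr a) = ratr g.[a].
Proof. by rewrite /evalC horner_map. Qed.

Lemma minQpoly_ratr a : minQpoly (ratr a) = 'X - a%:P.
Proof.
apply: monic_irreducible_dvdp (minQpoly_monic _) (minQpoly_irr _) _ _ _.
- exact: monicXsubC.
- exact: irredp_XsubC.
- by rewrite minQpoly_dvd evalC_ratr hornerXsubC subrr rmorph0.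
Qed.

Lemma deg_minQpoly_prim_root d z :
  d.-primitive_root z -> deg (minQpoly z) = totient d.
Proof.
move=> prim_z; rewrite /deg -(size_map_poly (ratr : {rmorphism rat -> algC})).
by rewrite minQpolyE (minCpoly_cyclotomic prim_z) size_cyclotomic.
Qed.

(** Over [algC] both become the [d]-th cyclotomic polynomial, the image of an integer polynomial
    that depends on [d] only. *)
Lemma minQpoly_prim_root d z z' :
  d.-primitive_root z -> d.-primitive_root z' -> minQpoly z = minQpoly z'.
Proof.
move=> prim_z prim_z'; apply: (map_poly_inj (ratr : {rmorphism rat -> algC})).
rewrite !minQpolyE (minCpoly_cyclotomic prim_z) (minCpoly_cyclotomic prim_z').
by rewrite -(Cintr_Cyclotomic prim_z) (Cintr_Cyclotomic prim_z').
Qed.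

(** * Degrees and the tower law *)

Lemma num_field_horner (Qs : fieldExtType rat) (QsC : {rmorphism Qs -> algC})
    p y : QsC (map_poly (in_alg Qs) p).[y] = evalC p (QsC y).
Proof.
rewrite /evalC -horner_map -map_poly_comp; congr _.[_].
by apply: eq_map_poly => a /=; rewrite alg_num_field fmorph_rat.
Qed.

(** This turns degrees of minimal polynomials into dimensions of subfields. [minPoly 1 y] is the
    image of a rational polynomial [q]; it divides the image of [minQpoly (QsC y)], which in turn
    divides [q], so the sizes agree. *)
Lemma num_field_adjoin_degree (Qs : fieldExtType rat)
    (QsC : {rmorphism Qs -> algC}) y :
  adjoin_degree 1 y = deg (minQpoly (QsC y)).
Proof.
have toC q : root (map_poly (in_alg Qs) q) y = (minQpoly (QsC y) %| q).
  by rewrite minQpoly_dvd -num_field_horner fmorph_eq0.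
apply/eqP; rewrite /deg -eqSS -size_minPoly prednK; last first.
  by rewrite size_poly_gt0 monic_neq0 ?minQpoly_monic.
have [q Dq] := polyOver1P (minPolyOver 1 y); rewrite eqn_leq.
rewrite -{1}(size_map_poly (in_alg Qs)) dvdp_leq; first last.
- by apply: minPoly_dvdp; rewrite ?toC ?dvdpp //; apply/polyOver1P; eexists.
- by rewrite map_poly_eq0 monic_neq0 ?minQpoly_monic.
rewrite Dq size_map_poly dvdp_leq // -?toC -?Dq ?root_minPoly //.
by rewrite -(map_poly_eq0 (in_alg Qs)) -Dq monic_neq0 ?monic_minPoly.
Qed.

Lemma deg_minQpoly_evalC g z : (deg (minQpoly (evalC g z)) %| deg (minQpoly z))%N.
Proof.
have [Qs [QsC [[|w [|]] //= [<-] _]]] := num_field_exists [:: z].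
rewrite -num_field_horner -!num_field_adjoin_degree.
set y := _.[w]; have: (<<1; y>> <= <<1; w>>)%VS.
  by apply/FadjoinP; rewrite sub1v; split=> //; apply/Fadjoin1_polyP; exists g.
by move/field_dimS; rewrite !dim_Fadjoin dimv1 !muln1.
Qed.

Lemma prim_roots_dvdp n (zeta : nat -> algC) (r : {poly rat}) :
    (0 < n)%N -> (forall d, (d %| n)%N -> d.-primitive_root (zeta d)) ->
  reflect (forall d, (d %| n)%N -> evalC r (zeta d) = 0) ('X^n - 1 %| r).
Proof.
move=> n_gt0 zetaP; apply: (iffP idP) => [/dvdpP[q ->] d d_n | r0].
  rewrite /evalC rmorphM hornerM rmorphB rmorph1 /= map_polyXn.
  have /dvdnP[k ->] := d_n; rewrite mulnC hornerD hornerN hornerXn hornerC.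
  by rewrite exprM (prim_expr_order (zetaP d d_n)) expr1n subrr mulr0.
have prim_z := zetaP n (dvdnn n).
rewrite -(dvdp_map (ratr : {rmorphism rat -> algC})) rmorphB rmorph1 /=.
rewrite map_polyXn -(factor_Xn_sub_1 prim_z) /index_iota subn0.
rewrite -(big_map (fun i => zeta n ^+ i) xpredT (fun x => 'X - x%:P)).
apply: uniq_roots_dvdp; last first.
  rewrite uniq_rootsE map_inj_in_uniq ?iota_uniq // => i j.
  rewrite !mem_iota /= => i_n j_n /eqP.
  by rewrite (eq_prim_root_expr prim_z) !modn_small // => /eqP.
apply/allP=> _ /mapP[i _ ->]; set x := _ ^+ i.
have x_n : x ^+ n = 1 by rewrite -exprM mulnC exprM (prim_expr_order prim_z) expr1n.
have [d prim_x d_n] := prim_order_exists n_gt0 x_n.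
(* [x] and [zeta d] have the same order, hence the same minimal polynomial, so [r] vanishes at both
   or at neither. *)
rewrite /root -/(evalC r x) -minQpoly_dvd.
by rewrite (minQpoly_prim_root prim_x (zetaP d d_n)) minQpoly_dvd r0.
Qed.

(** * The fundamental circulant matrix and its annihilating polynomials *)

Section FundamentalCirculant.

Variable m : nat.
Local Notation W := (fund_circ m.+1).
(** Unit rows are indexed modulo [m.+1], so that multiplying by [W] on the right is the shift [k] to
    [k.+1] with no boundary case. *)
Let e k : 'rV[rat]_m.+1 := delta_mx 0 (inord (k %% m.+1)).

Let e_mulW k : e k *m W = e k.+1.
Proof.
rewrite -rowE; apply/rowP=> j; rewrite !mxE eqxx /= inordK ?ltn_pmod //.
rewrite -val_eqE /= inordK ?ltn_pmod // -[k.+1]addn1 -modnDml addn1.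
have: (k %% m.+1 <= m)%N by rewrite -ltnS ltn_pmod.
(* When [k] is congruent to [m], the row of [W] is the last one and its 1 is in column 0; otherwise
   nothing wraps around. *)
rewrite eqSS leq_eqVlt; case/predU1P=> [-> | lt_k].
  by rewrite modnn eqxx ltn_eqF.
by rewrite (ltn_eqF lt_k) orbF [(_.+1 %% _)%N]modn_small.
Qed.

Let e_mulWX k j : e k *m (W ^+ j) = e (k + j).
Proof.
elim: j => [|j IHj]; first by rewrite addn0 expr0 mulmx1.
by rewrite exprSr mulmxA IHj e_mulW addnS.
Qed.

Lemma fund_circ_expn : W ^+ m.+1 = 1.
Proof.
apply/row_matrixP=> i; rewrite !rowE mulmx1.
have -> : delta_mx 0 i = e i by rewrite /e modn_small // inord_val.
by rewrite e_mulWX /e modnDr.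
Qed.

Lemma horner_fund_circ_eq0 (r : {poly rat}) :
  (horner_mx W r == 0) = ('X^(m.+1) - 1 %| r).
Proof.
have W0 : horner_mx W ('X^(m.+1) - 1) = 0.
  by rewrite rmorphB rmorphXn /= horner_mx_X rmorph1 fund_circ_expn subrr.
(* Only the remainder modulo ['X^(m.+1) - 1] matters, and its size is at most [m.+1]. *)
have D : horner_mx W r = horner_mx W (r %% ('X^(m.+1) - 1)).
  by rewrite {1}(divp_eq r ('X^(m.+1) - 1)) rmorphD rmorphM /= W0 mulr0 add0r.
rewrite D /dvdp; set r0 := r %% _.
apply/eqP/eqP=> [r0W | ->]; last by rewrite rmorph0.
have sz_r0 : (size r0 <= m.+1)%N.
  rewrite -ltnS -(size_XnsubC (1 : rat) (ltn0Sn m)) ltn_modp.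
  by rewrite -size_poly_eq0 size_XnsubC.
have r0E : r0 = \sum_(i < m.+1) r0`_i *: 'X^i.
  rewrite -poly_def; apply/polyP=> i; rewrite coef_poly.
  by case: ltnP => // /(leq_trans sz_r0) /leq_sizeP ->.
apply/polyP=> k; rewrite coef0; case: (ltnP k m.+1) => [lt_k | le_k]; last first.
  by apply: (leq_sizeP _ _ sz_r0).
(* The first row of [r0(W)] lists the coefficients of [r0]; its entry [k] is read off here. *)
rewrite r0E in r0W; have := congr1 (fun B => (e 0 *m B) 0 (Ordinal lt_k)) r0W.
rewrite mulmx0 rmorph_sum mulmx_sumr summxE mxE /=.
rewrite (bigD1 (Ordinal lt_k)) //= big1 => [|i neq_ik].
  rewrite horner_mxZ -scalemxAr rmorphXn /= horner_mx_X e_mulWX !mxE.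
  have -> : inord ((0 + k) %% m.+1) = Ordinal lt_k.
    by apply: val_inj; rewrite /= add0n modn_small // inordK.
  by rewrite !eqxx mulr1 addr0.
rewrite horner_mxZ -scalemxAr rmorphXn /= horner_mx_X e_mulWX !mxE.
by rewrite add0n modn_small // inord_val eq_sym (negPf neq_ik) mulr0.
Qed.

End FundamentalCirculant.

(** * Composition at a matrix, and rings with a common presentation *)

Lemma horner_mx_comp (F : fieldType) m (B : 'M[F]_m.+1) (p q : {poly F}) :
  horner_mx B (p \Po q) = horner_mx (horner_mx B q) p.
Proof.
elim/poly_ind: p => [|p c IHp]; first by rewrite comp_poly0 !rmorph0.
rewrite comp_polyD comp_polyM comp_polyX comp_polyC !rmorphD !rmorphM /=.
by rewrite IHp horner_mx_X !horner_mx_C.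
Qed.

(** The isomorphism sends [f p] to [h p]; equal kernels make it well defined and injective. Choice
    supplies sections [s] and [t], so the map is [h \o s] with inverse [f \o t]. *)
Lemma ring_isomorphic_quotients (P R S : pzRingType)
    (f : {rmorphism P -> R}) (h : {rmorphism P -> S}) :
    (forall x, exists p, f p = x) -> (forall y, exists p, h p = y) ->
    (forall p, f p = 0 <-> h p = 0) ->
  ring_isomorphic R S.
Proof.
move=> /choice[s fs] /choice[t ht] ker_fh.
have hf p q : f p = f q -> h p = h q.
  move=> /eqP; rewrite -subr_eq0 -rmorphB => /eqP/ker_fh/eqP.
  by rewrite rmorphB subr_eq0 => /eqP.
have fh p q : h p = h q -> f p = f q.
  move=> /eqP; rewrite -subr_eq0 -rmorphB => /eqP/ker_fh/eqP.
  by rewrite rmorphB subr_eq0 => /eqP.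
pose k x := h (s x).
have kB : zmod_morphism k.
  by move=> x y; rewrite /k -rmorphB; apply: hf; rewrite rmorphB !fs.
have kM : monoid_morphism k.
  split=> [|x y]; first by rewrite /k -(rmorph1 h); apply: hf; rewrite fs rmorph1.
  by rewrite /k -rmorphM; apply: hf; rewrite rmorphM !fs.
pose kA := GRing.isZmodMorphism.Build R S k kB.
pose kMM := GRing.isMonoidMorphism.Build R S k kM.
pose K : {rmorphism R -> S} := HB.pack k kA kMM.
exists K; exists (fun y => f (t y)) => [x | y] /=.
  by rewrite -[RHS]fs; apply: fh; rewrite ht.
by rewrite -[RHS]ht; apply: hf; rewrite fs.
Qed.

(** * The field Q(a) as a quotient of Q[X] *)

Section EvalQadj.

Variable a : algC.

Fact evalC_in_Qadj p : evalC p a \in in_Qadj a.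
Proof.
apply/in_QadjP=> K Ka; rewrite /evalC rpred_horner //.
by apply/polyOverP=> i; rewrite coef_map /= rpred_rat.
Qed.

Definition Qadj_eval p : Qadj a := MkQadj (evalC_in_Qadj p).

Fact Qadj_eval_zmod_morphism : zmod_morphism Qadj_eval.
Proof.
by move=> p q; apply: val_inj; rewrite rmorphB /= /evalC rmorphB hornerD hornerN.
Qed.

Fact Qadj_eval_monoid_morphism : monoid_morphism Qadj_eval.
Proof.
split=> [|p q]; apply: val_inj; rewrite ?rmorph1 ?rmorphM /= /evalC.
  by rewrite rmorph1 hornerC.
by rewrite rmorphM hornerM.
Qed.

HB.instance Definition _ :=
  GRing.isZmodMorphism.Build {poly rat} (Qadj a) Qadj_eval
    Qadj_eval_zmod_morphism.
HB.instance Definition _ :=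
  GRing.isMonoidMorphism.Build {poly rat} (Qadj a) Qadj_eval
    Qadj_eval_monoid_morphism.

(** This is Q[a]. Once it is known to be a field, it is one of the subfields whose intersection
    defines [Qadj a]. *)
Definition evalC_range : {pred algC} := [pred x | `[< exists p, evalC p a = x >]].

Fact evalC_rangeP x : reflect (exists p, evalC p a = x) (x \in evalC_range).
Proof. exact: asboolP. Qed.

(* A nonzero value p(a) is inverted by a Bezout relation between p and the
   minimal polynomial of a. *)
Fact evalC_range_divring : divring_closed evalC_range.
Proof.
split.
- by apply/evalC_rangeP; exists 1; rewrite /evalC rmorph1 hornerC.
- move=> _ _ /evalC_rangeP[p <-] /evalC_rangeP[q <-]; apply/evalC_rangeP.
  by exists (p - q); rewrite /evalC rmorphB hornerD hornerN.
- move=> _ _ /evalC_rangeP[p <-] /evalC_rangeP[q <-]; apply/evalC_rangeP.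
  have [q0 | q_neq0] := eqVneq (evalC q a) 0.
    by exists 0; rewrite q0 invr0 mulr0 /evalC rmorph0 horner0.
  have: coprimep (minQpoly a) q.
    by rewrite irreducible_poly_coprime ?minQpoly_dvd //; apply: minQpoly_irr.
  case/Bezout_eq1_coprimepP=> -[u v] /= uv.
  exists (p * v); apply: (canRL (mulfK q_neq0)).
  have /eqP a0 : evalC (minQpoly a) a == 0 by rewrite -minQpoly_dvd.
  have := congr1 (fun w => evalC w a) uv; rewrite /evalC rmorphD !rmorphM /=.
  rewrite hornerD !hornerM -/(evalC (minQpoly a) a) a0 mulr0 add0r => vq.
  by rewrite -mulrA vq rmorph1 hornerC mulr1.
Qed.

HB.instance Definition _ :=
  GRing.isDivringClosed.Build algC evalC_range evalC_range_divring.

Lemma Qadj_eval_surj (x : Qadj a) : exists p, Qadj_eval p = x.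
Proof.
case: x => x Qx; have /in_QadjP/(_ evalC_range) := Qx.
case/(_ _)/evalC_rangeP=> [|p Dx]; last by exists p; apply: val_inj.
by apply/evalC_rangeP; exists 'X; rewrite /evalC map_polyX hornerX.
Qed.

Lemma Qadj_eval_eq0 p : (Qadj_eval p == 0) = (minQpoly a %| p).
Proof. by rewrite minQpoly_dvd. Qed.

End EvalQadj.

(** * The ring F[A]/(c(A)) as a quotient of F[X] *)

Section QuotientOfMatrixAlgebra.

Variables (F : fieldType) (m : nat) (A : 'M[F]_m.+1) (c : {poly F}).
Local Open Scope quotient_scope.

Definition mxalg_quot (p : {poly F}) : gen_quot (mxalg_horner A c) :=
  \pi_(gen_quot (mxalg_horner A c)) (mxalg_horner A p).

Fact mxalg_quot_zmod_morphism : zmod_morphism mxalg_quot.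
Proof.
move=> p q; rewrite /mxalg_quot.
have -> : mxalg_horner A (p - q) = mxalg_horner A p - mxalg_horner A q.
  by apply: val_inj; rewrite rmorphB /= rmorphB.
exact: raddfB.
Qed.

Fact mxalg_quot_monoid_morphism : monoid_morphism mxalg_quot.
Proof.
split=> [|p q]; rewrite /mxalg_quot.
  have -> : mxalg_horner A 1 = 1 by apply: val_inj; rewrite /= !rmorph1.
  by rewrite [RHS]/GRing.one /= piE.
have -> : mxalg_horner A (p * q) = mxalg_horner A p * mxalg_horner A q.
  by apply: val_inj; rewrite rmorphM /= rmorphM.
exact: pi_gen_quot_mul.
Qed.

HB.instance Definition _ :=
  GRing.isZmodMorphism.Build {poly F} (gen_quot (mxalg_horner A c)) mxalg_quot
    mxalg_quot_zmod_morphism.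
HB.instance Definition _ :=
  GRing.isMonoidMorphism.Build {poly F} (gen_quot (mxalg_horner A c)) mxalg_quot
    mxalg_quot_monoid_morphism.

Lemma mxalg_quot_surj y : exists p, mxalg_quot p = y.
Proof.
rewrite -[y]reprK; case: (repr y) => X AX; have /in_mxalgP[p DX] := AX.
by exists p; congr (\pi _); apply: val_inj.
Qed.

(** If p(A) = q(A)c(A), then the minimal polynomial of [A] divides p - qc; as [c] divides it, [c]
    divides p. *)
Lemma mxalg_quot_eq0 p :
  c %| mxminpoly A -> (mxalg_quot p == 0) = (c %| p).
Proof.
move=> c_A; rewrite -(rmorph0 mxalg_quot) -Quotient.idealrBE.
have -> : mxalg_horner A p - mxalg_horner A 0 = mxalg_horner A p.
  by apply: val_inj; rewrite rmorphB /= rmorph0 subr0.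
apply/gen_idealP/idP=> [[[X AX]] | /dvdpP[q ->]]; last first.
  by exists (mxalg_horner A q); apply: val_inj; rewrite rmorphM /= rmorphM.
have /in_mxalgP[q DX] := AX; move/(congr1 val); rewrite rmorphM /= DX.
rewrite -rmorphM => /eqP; rewrite -subr_eq0 -rmorphB => /eqP/mxminpoly_min.
by move=> /(dvdp_trans c_A); rewrite dvdp_subl // dvdp_mull.
Qed.

End QuotientOfMatrixAlgebra.

Unset Implicit Arguments.
Set Strict Implicit.

(* The positive integer n is m.+1. *)
Theorem theorem2p2 (m : nat) (g : {poly rat}) (zeta : nat -> algC)
    (deg_g : (1 <= deg g <= m.+1 - 1)%N)
    (zetaP : forall d : nat, (d %| m.+1)%N -> d.-primitive_root (zeta d)) :
  let n := m.+1 in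
  let A : 'M[rat]_m.+1 := horner_mx (fund_circ m.+1) g in
  let p_A := mxminpoly A in
  let chi (d : nat) := minQpoly (evalC g (zeta d)) in
  [/\ max_sqfree_factor (\prod_(d <- divisors n) chi d) p_A
        /\ (forall d : nat, (d %| n)%N -> (deg (chi d) %| deg 'Phi_d)%N),
      exists2 s : seq {poly rat},
        monic_irr_factors p_A s & (size s <= size (divisors n))%N,
      forall d : nat, (d %| n)%N ->
        ring_isomorphic (Qadj (evalC g (zeta d)))
                        (gen_quot (mxalg_horner A (chi d)))
    & prime n ->
        exists q1 q2 : {poly rat},
          [/\ monic_irr_factors p_A [:: q1; q2],
              deg q1 = 1%N & (deg q2 %| n - 1)%N] ].
Proof.
move=> n A p_A chi.
have n_gt0 : (0 < n)%N by [].
have chi_irr d : chi d \is monic /\ irreducible_poly (chi d).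
  by split; [apply: minQpoly_monic | apply: minQpoly_irr].
pose s := undup [seq chi d | d <- divisors n].
have s_chi q : q \in s -> q \is monic /\ irreducible_poly q.
  by rewrite mem_undup => /mapP[d _ ->].
have uniq_s : uniq s by apply: undup_uniq.
have chi_in_s d : (d %| n)%N -> chi d \in s.
  by rewrite mem_undup dvdn_divisors // => n_d; rewrite map_f.
(* q(A) is [q \Po g] at the circulant, so it vanishes iff [q] vanishes at every g(zeta_d). *)
have hornerA q : (p_A %| q) = all (fun r => r %| q) s.
  rewrite dvd_mxminpoly -horner_mx_comp horner_fund_circ_eq0.
  apply/(prim_roots_dvdp _ n_gt0 zetaP)/allP => [q0 r | q0 d n_d].
    rewrite mem_undup => /mapP[d]; rewrite -dvdn_divisors // => n_d ->.
    by rewrite minQpoly_dvd -evalC_comp q0.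
  by rewrite evalC_comp; apply/eqP; rewrite -minQpoly_dvd q0 ?chi_in_s.
(* Two monic polynomials that divide the same polynomials are equal. *)
have p_A_E : p_A = \prod_(q <- s) q.
  apply/eqP; rewrite -eqp_monic ?mxminpoly_monic //; last first.
    by rewrite big_seq; apply: monic_prod => q /s_chi[].
  rewrite /eqp hornerA -dvdp_prod_irreducible // dvdpp.
  by rewrite dvdp_prod_irreducible // -hornerA dvdpp.
have chi_p_A d : (d %| n)%N -> chi d %| p_A.
  by move=> n_d; rewrite p_A_E (big_rem (chi d)) ?chi_in_s //= dvdp_mulr.
have deg_chi d : (d %| n)%N -> (deg (chi d) %| totient d)%N.
  move=> n_d; rewrite -(deg_minQpoly_prim_root (zetaP d n_d)).
  exact: deg_minQpoly_evalC.
split.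
- split=> [|d n_d]; last by rewrite {2}/deg size_Cyclotomic deg_chi.
  exists s => //; rewrite -(big_map chi xpredT id).
  apply: monic_irr_factors_prod => // [q /mapP[d _ ->] // | q].
  by rewrite mem_undup.
- exists s; first by rewrite p_A_E; apply: monic_irr_factors_prod.
  by rewrite (leq_trans (size_undup _)) // size_map.
- move=> d n_d.
  apply: (@ring_isomorphic_quotients _ _ _ (Qadj_eval (evalC g (zeta d)))
            (mxalg_quot A (chi d))) => [||p].
  - exact: Qadj_eval_surj.
  - exact: mxalg_quot_surj.
  split=> /eqP.
    by rewrite Qadj_eval_eq0 => c_p; apply/eqP; rewrite mxalg_quot_eq0 ?chi_p_A.
  by rewrite mxalg_quot_eq0 ?chi_p_A // => c_p; apply/eqP; rewrite Qadj_eval_eq0.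
- move=> pr_n; exists (chi 1%N), (chi n).
  (* The only primitive first root of unity is 1, so [chi 1] is the linear polynomial X - g(1). *)
  have zeta1 : zeta 1%N = ratr 1.
    by have := prim_expr_order (zetaP 1%N (dvd1n _)); rewrite expr1 rmorph1.
  have chi1 : chi 1%N = 'X - g.[1]%:P.
    by rewrite /chi zeta1 evalC_ratr minQpoly_ratr.
  have divn d : (d %| n)%N -> d = 1%N \/ d = n.
    by case/primeP: pr_n => _ pr /pr /orP[/eqP | /eqP]; [left | right].
  split.
  + rewrite p_A_E; apply: monic_irr_factors_prod => // [|q].
      rewrite /= andbT inE; apply/eqP=> chi_1n.
      have : 'X^n - 1 %| g - g.[1]%:P.
        apply/(prim_roots_dvdp _ n_gt0 zetaP) => d /divn Dd; apply/eqP.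
        (* As a composition with [g], its value at [zeta d] is that of [chi 1] at g(zeta_d), and
           [chi 1] equals [chi d] for both divisors. *)
        have -> : g - g.[1]%:P = ('X - g.[1]%:P) \Po g.
          by rewrite comp_polyB comp_polyX comp_polyC.
        rewrite evalC_comp -minQpoly_dvd -chi1 -/(chi d).
        by case: Dd => ->; rewrite // chi_1n.
      have [g_gt1 g_le] : (1 < size g)%N /\ (size g <= n)%N.
        move: deg_g; rewrite /deg subSS subn0 => /andP[].
        by case: (size g) => [|[]].
      (* Since [g] is not constant, subtracting g(1) keeps its size: the difference is nonzero of
         size at most [n], whereas ['X^n - 1] has size [n.+1]. *)
      have sz_g : size (g - g.[1]%:P) = size g.
        by rewrite size_polyDl // size_polyN (leq_ltn_trans (size_polyC_leq1 _)).
      move/dvdp_leq; rewrite sz_g -size_poly_gt0 sz_g size_XnsubC //.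
      by move/(_ (ltnW g_gt1)); rewrite ltnNge g_le.
    rewrite !inE mem_undup; apply/orP/mapP=> [[]/eqP-> | [d]].
    * by exists 1%N; rewrite // -dvdn_divisors ?dvd1n.
    * by exists n; rewrite // -dvdn_divisors.
    * by rewrite -dvdn_divisors // => /divn[]-> ->; rewrite eqxx; [left | right].
  + by rewrite chi1 /deg size_XsubC.
  + by rewrite subn1 -totient_prime ?deg_chi.
Qed.
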